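(* Let $X$ be an arbitrary bounded metric space, let $m\ge 1$ be a (finite or infinite) cardinal number such that $m\le \#X$, and let $\lambda$ be an arbitrary real number with $0<\lambda<\operatorname{diam} X$. Then $X$ can be partitioned into $m$ subsets having strictly smaller diameters if and only if $2d_{GH}(\lambda\Delta_m,X)<\operatorname{diam} X$.
   Context: Metric spaces are non-empty. $\#X$ denotes the cardinality of $X$, $|xy|$ the distance between points $x,y$ of a metric space, and $\operatorname{diam} X=\sup\{|xy|: x,y\in X\}$; $X$ is bounded if $\operatorname{diam} X<\infty$. Partitions: for a cardinal $m\le\#X$, a partition of $X$ into $m$ subsets is a family $D=\{X_i\}_{i\in I}$ of pairwise disjoint non-empty subsets of $X$ with union $X$ and with $\#I=m$. It is called a partition into subsets having strictly smaller diameters if there exists $\varepsilon>0$ such that $\operatorname{diam} X_i\le \operatorname{diam} X-\varepsilon$ for all $i\in I$ (one $\varepsilon$ for all $i$). Simplexes: $\Delta_m$ (the unit simplex) is the metric space of cardinality $m$ all of whose non-zero distances equal $1$. For a metric space $Y$ and $\lambda>0$, $\lambda Y$ is the metric space obtained from $Y$ by multiplying all distances by $\lambda$; thus $\lambda\Delta_m$ has cardinality $m$ and all its non-zero distances equal $\lambda$. Gromov--Hausdorff distance: for non-empty subsets $A,B$ of a metric space $Z$, the Hausdorff distance is $d_H(A,B)=\max\{\sup_{a\in A}|aB|,\ \sup_{b\in B}|Ab|\}$, where $|aB|=\inf_{b\in B}|ab|$ and $|Ab|=\inf_{a\in A}|ab|$. For metric spaces $X,Y$ (not assumed compact), $d_{GH}(X,Y)$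 is the infimum of real numbers $r$ such that there exist a metric space $Z$ and subsets $X',Y'\subset Z$ isometric to $X$ and $Y$ respectively with $d_H(X',Y')\le r$. *)

(* Defs.v *)
From HB Require Import structures.
From mathcomp Require Import all_boot all_order all_algebra.
From mathcomp Require Import all_classical all_reals all_analysis.

Set Implicit Arguments.
Unset Strict Implicit.
Unset Printing Implicit Defensive.

Import Order.TTheory GRing.Theory Num.Theory.

Local Open Scope classical_set_scope.
Local Open Scope ring_scope.

(* Cardinal numbers are represented by types: the index type [I] stands for
   the cardinal #I, and [unit_simplex R I] is the unit simplex on #I points. *)
Definition unit_simplex (R : realType) (I : Type) : Type := I.

Section UnitSimplex.
Context (R : realType) (I : Type).

HB.instance Definition _ := gen_eqMixin (unit_simplex R I).
HB.instance Definition _ := gen_choiceMixin (unit_simplex R I).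

Definition simplex_dist (i j : unit_simplex R I) : R := (i != j)%:R.

Fact simplex_distxx i : simplex_dist i i = 0.
Proof. by rewrite /simplex_dist eqxx. Qed.

Fact simplex_dist_eq0 i j : simplex_dist i j = 0 -> i = j.
Proof.
rewrite /simplex_dist; have [//|_ /eqP] := eqVneq i j.
by rewrite oner_eq0.
Qed.

Fact simplex_dist_sym i j : simplex_dist i j = simplex_dist j i.
Proof. by rewrite /simplex_dist eq_sym. Qed.

Fact simplex_dist_triangle j i k :
  simplex_dist i k <= simplex_dist i j + simplex_dist j k.
Proof.
rewrite /simplex_dist -natrD ler_nat.
have [->|] := eqVneq i j; first by rewrite add0n.
by move=> _; case: (i != k); rewrite ?addn_gt0.
Qed.

HB.instance Definition _ := isMetric.Build R (unit_simplex R I)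
  simplex_distxx simplex_dist_eq0 simplex_dist_sym simplex_dist_triangle.

Lemma unit_simplexE (i j : unit_simplex R I) : mdist i j = (i != j)%:R.
Proof. by []. Qed.

End UnitSimplex.

Definition rescale (R : realType) (l : R) (l0 : 0 < l) (Y : metricType R) :
  Type := Y.

Section Rescale.
Context (R : realType) (l : R) (l0 : 0 < l) (Y : metricType R).

HB.instance Definition _ := Choice.copy (rescale l0 Y) Y.

Definition rescale_dist (x y : rescale l0 Y) : R := l * @mdist R Y x y.

Fact rescale_distxx x : rescale_dist x x = 0.
Proof. by rewrite /rescale_dist mdistxx mulr0. Qed.

Fact rescale_dist_eq0 x y : rescale_dist x y = 0 -> x = y.
Proof.
move=> /eqP; rewrite /rescale_dist mulf_eq0 gt_eqF//= => /eqP.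
exact: mdist_positivity.
Qed.

Fact rescale_dist_sym x y : rescale_dist x y = rescale_dist y x.
Proof. by rewrite /rescale_dist metric_sym. Qed.

Fact rescale_dist_triangle y x z :
  rescale_dist x z <= rescale_dist x y + rescale_dist y z.
Proof. by rewrite /rescale_dist -mulrDr ler_pM2l// metric_triangle. Qed.

HB.instance Definition _ := isMetric.Build R (rescale l0 Y)
  rescale_distxx rescale_dist_eq0 rescale_dist_sym rescale_dist_triangle.

Lemma rescaleE (x y : rescale l0 Y) : mdist x y = l * @mdist R Y x y.
Proof. by []. Qed.

End Rescale.

Local Open Scope ereal_scope.

Section MetricNotions.
Context (R : realType).

Definition diam (X : metricType R) (A : set X) : \bar R :=
  ereal_sup [set (mdist x y)%:E | x in A & y in A].

Definition bounded_space (X : metricType R) : Prop := diam [set: X] < +oo.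

Definition strictly_smaller_diams (X : metricType R) (I : Type)
    (D : I -> set X) : Prop :=
  exists2 e : R, (0 < e)%R & forall i, diam (D i) <= diam [set: X] - e%:E.

Definition dist_to_set (Z : metricType R) (z : Z) (B : set Z) : \bar R :=
  ereal_inf [set (mdist z b)%:E | b in B].

Definition hausdorff_dist (Z : metricType R) (A B : set Z) : \bar R :=
  maxe (ereal_sup [set dist_to_set a B | a in A])
       (ereal_sup [set dist_to_set b A | b in B]).

Definition isometric_to (X Z : metricType R) (A : set Z) : Prop :=
  exists2 f : X -> Z,
    forall x y, mdist (f x) (f y) = mdist x y & range f = A.

Definition gromov_hausdorff_dist (X Y : metricType R) : \bar R :=
  ereal_inf [set r%:E | r in [set r : R |
    exists (Z : metricType R) (X' Y' : set Z),
      [/\ isometric_to X X', isometric_to Y Y'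
        & hausdorff_dist X' Y' <= r%:E]]].

End MetricNotions.

(* Main.v *)
(* [d_GH(l Delta_m, X)] is half the infimal distortion of a correspondence.  A
   partition of [X] is a correspondence of distortion at most
   [max (diam X - e) l (diam X - l)].  Conversely, choosing for each point a
   vertex related to it by a correspondence of distortion [d < diam X] yields a
   partition into at most [m] sets of diameter at most [d].  It refines to
   exactly [m] sets because [m <= #X]: either the unused vertices inject into
   the complement of a transversal, whose points can be split off as
   singletons, or that complement injects into the unused vertices, so that
   [m = #X] and the partition into singletons will do. *)
Require Import Defs.
From HB Require Import structures.
From mathcomp Require Import all_boot all_order all_algebra.
From mathcomp Require Import all_classical all_reals all_analysis.
From mathcomp Require Import lra.

Import Order.TTheory GRing.Theory Num.Theory.

Set Implicit Arguments.
Unset Strict Implicit.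
Unset Printing Implicit Defensive.

Local Open Scope classical_set_scope.
Local Open Scope card_scope.
Local Open Scope ereal_scope.

(** * Comparability of cardinals and refinement of partitions *)

(** Zorn's lemma yields a maximal graph [G] of a partial bijection between [A] and [B]. It cannot
    miss a point on both sides, so it is total on one of them and gives an injection from there. *)
Lemma card_le_total (T U : Type) (A : set T) (B : set U) : A #<= B \/ B #<= A.
Proof.
elim/Ppointed: T => T in A *; first by left; rewrite !emptyE_subdef.
elim/Ppointed: U => U in B *; first by right; rewrite !emptyE_subdef.
(* The equivalence says at once that [G] is single-valued and injective. *)
pose P (G : set (T * U)) := G `<=` A `*` B /\
  forall p q, G p -> G q -> p.1 = q.1 <-> p.2 = q.2.
have [F FP Ftot|G [[GAB Ginj] Gmax]] := @Zorn_bigcup _ P.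
  split=> [p [G /FP[GAB _]]|p q [G FG Gp] [H FH Hq]]; first exact: GAB.
  have [GH|HG] := Ftot _ _ FG FH.
    by have [_] := FP _ FH; apply=> //; exact: GH.
  by have [_] := FP _ FG; apply=> //; exact: HG.
have [Gdom|/existsNP[a /not_implyP[Aa Ga]]] :=
    pselect (forall a, A a -> exists b, G (a, b)).
  left; apply/pcard_leP/injfunPex.
  have [f Gf] : {f : T -> U & forall a, A a -> G (a, f a)}.
    apply: (@choice _ _ (fun a b => A a -> G (a, b))) => a.
    by have [/Gdom[b Gab]|nAa] := pselect (A a); [exists b | exists point].
  exists f => [a /Gf/GAB[]//|a b /set_mem Aa /set_mem Ab fab].
  exact: (Ginj _ _ (Gf _ Aa) (Gf _ Ab)).2.
right; apply/pcard_leP/injfunPex.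
(* Pairing an unmatched [b] with the unmatched [a] would enlarge [G]. *)
have Grng b : B b -> exists a, G (a, b).
  move=> Bb; apply: contrapT => Gb; apply: (Gmax (G `|` [set (a, b)])).
    split=> [p|/(_ (a, b))]; first by left.
    by move=> /(_ (or_intror erefl)) Gab; apply: Ga; exists b.
  split=> [_ [/GAB//|->//]|p q [Gp|->] [Gq|->]//=]; first exact: Ginj.
    split=> e; exfalso; [apply: Ga; exists p.2|apply: Gb; exists p.1];
      by rewrite -e; case: p Gp {e}.
  split=> e; exfalso; [apply: Ga; exists q.2|apply: Gb; exists q.1];
    by rewrite e; case: q Gq {e}.
have [f Gf] : {f : U -> T & forall b, B b -> G (f b, b)}.
  apply: (@choice _ _ (fun b a => B b -> G (a, b))) => b.
  by have [/Grng[a' Gab]|nBb] := pselect (B b); [exists a' | exists point].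
exists f => [b /Gf/GAB[]//|b b' /set_mem Bb /set_mem Bb' fbb'].
exact: (Ginj _ _ (Gf _ Bb) (Gf _ Bb')).1.
Qed.

Lemma surjective_refinement (X I : Type) (c : X -> I) :
  [set: I] #<= [set: X] ->
  exists2 c' : X -> I, (forall i, exists x, c' x = i) &
    forall x y, c' x = c' y -> c x = c y.
Proof.
elim/Ppointed: X => X in c *.
  rewrite !emptyE_subdef => I0.
  by exists c => // i; have : [set: I] i by []; rewrite I0.
elim/Ppointed: I => I in c *; first by case: (no (c point)).
move=> IX.
(* [t] picks a representative in each non-empty fibre of [c]; these form the transversal [T]. *)
have [t ct] : exists t : I -> X, forall x, c (t (c x)) = c x.
  have [t Ht] : {t : I -> X & forall i, (exists x, c x = i) -> c (t i) = i}.
    apply: (@choice _ _ (fun i x => (exists x', c x' = i) -> c x = i)) => i.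
    by have [[x <-]|nci] := pselect (exists x, c x = i);
      [exists x|exists point].
  by exists t => x; apply: Ht; exists x.
pose T := [set x | t (c x) = x].
have [/pcard_leP[u]|/pcard_leP[v]] := card_le_total (~` range c) (~` T).
  have uT := 'funS_u; have uinj := 'inj_u.
  pose c' x := if pselect (exists2 i, (~` range c) i & u i = x) is left e
    then sval (cid2 e) else c x.
  have c'u i : (~` range c) i -> c' (u i) = i.
    rewrite /c' => ci; case: pselect => [e|[]]; last by exists i.
    by case: cid2 => j /= cj /uinj; apply; rewrite inE.
  have c'c x : ~ (exists2 i, (~` range c) i & u i = x) -> c' x = c x.
    by rewrite /c'; case: pselect.
  exists c' => [i|x y].
    have [[x _ <-]|ci] := pselect (range c i); last by exists (u i); exact: c'u.
    (* The representative lies in [T], so it was not split off and its fibre stays non-empty. *)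
    exists (t (c x)); rewrite c'c ?ct// => -[j /uT nTu uj].
    by apply: nTu; rewrite /T/= uj ct.
  have [[i ci <-]|/[dup] nx /c'c ->] :=
    pselect (exists2 i, (~` range c) i & u i = x);
  have [[j cj <-]|/[dup] ny /c'c ->] :=
    pselect (exists2 i, (~` range c) i & u i = y); rewrite ?c'u//.
  - by move=> ->.
  - by move=> iy; case: ci; exists y.
  - by move=> iy; case: cj; exists x.
have vI := 'funS_v; have vinj := 'inj_v.
(* [c] is injective on [T] and [v] maps the other points outside the range of [c], so the two glue
   to an injection. *)
have XI : [set: X] #<= [set: I].
  apply/pcard_injP; exists (fun x => if pselect (T x) then c x else v x).
  move=> x y _ _; case: pselect => Tx; case: pselect => Ty.
  - by move=> /= cxy; rewrite -Tx -Ty cxy.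
  - by move=> /= cv; case: (vI _ Ty); exists x.
  - by move=> /= cv; case: (vI _ Tx); exists y.
  - by apply: vinj; rewrite inE.
have /pcard_eqP[f] := Cantor_Bernstein XI IX.
exists f => [i|x y /(inj (mem_setT _) (mem_setT _)) -> //].
by have [x _ fx] : (f @` setT) i := 'surj_f Logic.I; exists x.
Qed.

(** * Correspondences and the gluing of two metric spaces *)

Definition correspondence (X Y : Type) (P : set (X * Y)) : Prop :=
  (forall x, exists y, P (x, y)) /\ (forall y, exists x, P (x, y)).

Definition distortion_le (R : realType) (X Y : metricType R)
    (P : set (X * Y)) (d : R) : Prop :=
  forall p q, P p -> P q -> (`|mdist p.1 q.1 - mdist p.2 q.2| <= d)%R.

Section Bridge.
Local Open Scope ring_scope.
Context (R : realType) (X Y : metricType R) (P : set (X * Y)) (r : R).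
Context (P_neq0 : P !=set0) (r_gt0 : 0 < r) (Pr : distortion_le P (2 * r)).

(* The largest distance from [x] to [y] allowed by the triangle inequality
   once related points are put at distance [r]. *)
Definition bridge_dist (x : X) (y : Y) : R :=
  inf [set mdist x p.1 + r + mdist p.2 y | p in P].

Let bridge_dist_le p x y :
  P p -> bridge_dist x y <= mdist x p.1 + r + mdist p.2 y.
Proof.
move=> Pp; apply: ge_inf; last by exists p.
by exists 0 => _ [q _ <-]; rewrite !addr_ge0 ?mdist_ge0// ltW.
Qed.

Let le_bridge_dist z x y :
  (forall p, P p -> z <= mdist x p.1 + r + mdist p.2 y) -> z <= bridge_dist x y.
Proof.
move=> zP; apply: lb_le_inf => [|_ [p Pp <-]]; last exact: zP.
by have [p Pp] := P_neq0; exists (mdist x p.1 + r + mdist p.2 y); exists p.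
Qed.

Let bridge_dist_ge x y : r <= bridge_dist x y.
Proof.
apply: le_bridge_dist => p _.
by have := mdist_ge0 x p.1; have := mdist_ge0 p.2 y; lra.
Qed.

Let bridge_dist_related x y : P (x, y) -> bridge_dist x y = r.
Proof.
move=> Pxy; apply/eqP; rewrite eq_le bridge_dist_ge andbT.
by rewrite (le_trans (bridge_dist_le _ _ Pxy))//= !mdistxx addr0 add0r.
Qed.

Let bridge_dist_lip1 x x' y : bridge_dist x y <= mdist x x' + bridge_dist x' y.
Proof.
rewrite -lerBlDl; apply: le_bridge_dist => p Pp.
by have := bridge_dist_le x y Pp; have := metric_triangle x x' p.1; lra.
Qed.

Let bridge_dist_lip2 x y y' : bridge_dist x y <= bridge_dist x y' + mdist y' y.
Proof.
rewrite -lerBlDr; apply: le_bridge_dist => p Pp.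
by have := bridge_dist_le x y Pp; have := metric_triangle p.2 y' y; lra.
Qed.

(** Let the two bridges pass through related pairs [p] and [q]. Then [mdist p.1 q.1] exceeds
    [mdist p.2 q.2] by at most [2 * r], which the two summands [r] pay for. *)
Let le_bridge_dist1 x x' y : mdist x x' <= bridge_dist x y + bridge_dist x' y.
Proof.
rewrite -lerBlDr; apply: le_bridge_dist => p Pp.
rewrite lerBlDr -lerBlDl; apply: le_bridge_dist => q Pq.
have := Pr Pp Pq; rewrite ler_norml => /andP[_].
have := metric_triangle x p.1 x'; have := metric_triangle p.1 q.1 x'.
have := metric_triangle p.2 y q.2.
by rewrite (metric_sym x' q.1) (metric_sym q.2 y); lra.
Qed.

Let le_bridge_dist2 x y y' : mdist y y' <= bridge_dist x y + bridge_dist x y'.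
Proof.
rewrite -lerBlDr; apply: le_bridge_dist => p Pp.
rewrite lerBlDr -lerBlDl; apply: le_bridge_dist => q Pq.
have := Pr Pp Pq; rewrite ler_norml => /andP[+ _].
have := metric_triangle y p.2 y'; have := metric_triangle p.2 q.2 y'.
have := metric_triangle p.1 x q.1.
by rewrite (metric_sym y p.2) (metric_sym p.1 x); lra.
Qed.

Let glued_dist (u v : X + Y) : R :=
  match u, v with
  | inl x, inl x' => mdist x x'
  | inl x, inr y => bridge_dist x y
  | inr y, inl x => bridge_dist x y
  | inr y, inr y' => mdist y y'
  end.

Let glued_distxx u : glued_dist u u = 0.
Proof. by case: u => z /=; rewrite mdistxx. Qed.

Let glued_dist_eq0 u v : glued_dist u v = 0 -> u = v.
Proof.
case: u v => [x|y] [x'|y'] /=; [by move=> /mdist_positivity ->| | |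
  by move=> /mdist_positivity ->]; move=> b0.
  by have := bridge_dist_ge x y'; rewrite b0 leNgt r_gt0.
by have := bridge_dist_ge x' y; rewrite b0 leNgt r_gt0.
Qed.

Let glued_dist_sym u v : glued_dist u v = glued_dist v u.
Proof. by case: u v => [x|y] [x'|y'] //=; rewrite metric_sym. Qed.

Let glued_dist_triangle v u w :
  glued_dist u w <= glued_dist u v + glued_dist v w.
Proof.
case: u v w => [x|y] [x'|y'] [x''|y''] /=; rewrite ?metric_triangle//.
  by rewrite addrC (metric_sym x' x''); exact: bridge_dist_lip1.
by rewrite addrC (metric_sym y y'); exact: bridge_dist_lip2.
Qed.

(** The metric lives on the disjoint union; cross distances are at least [r > 0], so the two copies
    stay apart. *)
Lemma glued_metric : exists (Z : metricType R) (f : X -> Z) (g : Y -> Z),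
  [/\ forall x x', mdist (f x) (f x') = mdist x x',
      forall y y', mdist (g y) (g y') = mdist y y' &
      forall x y, P (x, y) -> mdist (f x) (g y) = r].
Proof.
pose Z : metricType R := HB.pack (X + Y)%type (isMetric.Build R (X + Y)%type
  glued_distxx glued_dist_eq0 glued_dist_sym glued_dist_triangle).
by exists Z, inl, inr.
Qed.

End Bridge.

(** * Gromov-Hausdorff distance through correspondences *)

(** In the glued space every point has a related point of the other copy at distance exactly [r]. *)
Lemma gromov_hausdorff_le (R : realType) (X Y : metricType R)
    (P : set (X * Y)) (r : R) :
  P !=set0 -> (0 < r)%R -> correspondence P -> distortion_le P (2 * r) ->
  gromov_hausdorff_dist X Y <= r%:E.
Proof.
move=> P0 r0 [PX PY] Pr.
have [Z [f [g [fE gE fgE]]]] := glued_metric P0 r0 Pr.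
apply: ge_ereal_inf; exists r%:E => //; exists r => //=.
exists Z, (range f), (range g); split; [by exists f|by exists g|].
rewrite /hausdorff_dist ge_max; apply/andP; split; apply: ge_ereal_sup.
  move=> _ [_ [x _ <-] <-]; have [y Pxy] := PX x.
  apply: ge_ereal_inf; exists (mdist (f x) (g y))%:E; last by rewrite fgE.
  by exists (g y) => //; exists y.
move=> _ [_ [y _ <-] <-]; have [x Pxy] := PY y.
apply: ge_ereal_inf; exists (mdist (g y) (f x))%:E.
  by exists (f x) => //; exists x.
by rewrite metric_sym fgE.
Qed.

(** Relate points whose images in [Z] are less than [r] apart. The strict bound provides partners
    even where an infimum is not attained, and triangle inequalities bound the distortion. *)
Lemma gromov_hausdorff_lt (R : realType) (X Y : metricType R) (r : R) :
  gromov_hausdorff_dist X Y < r%:E ->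
  exists2 P : set (X * Y), correspondence P & distortion_le P (2 * r).
Proof.
move=> /ereal_inf_lt[_ [s [Z [_ [_ [[f fE <-] [g gE <-]]]]]] + <-].
rewrite /hausdorff_dist ge_max => /andP[fs gs] sr.
exists [set p | (mdist (f p.1) (g p.2) < r)%R]; last first.
  move=> [x y] [x' y'] /= xy xy'; rewrite -fE -gE ler_norml.
  have := metric_triangle (f x) (g y) (f x').
  have := metric_triangle (g y) (g y') (f x').
  have := metric_triangle (g y) (f x) (g y').
  have := metric_triangle (f x) (f x') (g y').
  by rewrite (metric_sym (g y) (f x)) (metric_sym (g y') (f x')); lra.
split=> [x|y].
  have : dist_to_set (f x) (range g) < r%:E.
    by apply: le_lt_trans sr; apply: le_trans fs; apply: ereal_sup_ubound;
      exists (f x) => //; exists x.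
  by move=> /ereal_inf_lt[_ [_ [y _ <-] <-]]; exists y.
have : dist_to_set (g y) (range f) < r%:E.
  by apply: le_lt_trans sr; apply: le_trans gs; apply: ereal_sup_ubound;
    exists (g y) => //; exists y.
by move=> /ereal_inf_lt[_ [_ [x _ <-] <-]]; exists x; rewrite /= metric_sym.
Qed.

(** * Diameters and the equivalence *)

Lemma diam_leP (R : realType) (X : metricType R) (A : set X) (d : R) :
  diam A <= d%:E <-> forall x y, A x -> A y -> (mdist x y <= d)%R.
Proof.
split=> [Ad x y Ax Ay|Ad]; last first.
  by apply: ge_ereal_sup => _ [x Ax [y Ay <-]]; rewrite lee_fin; exact: Ad.
rewrite -lee_fin; apply: le_trans Ad; apply: ereal_sup_ubound.
by exists x => //; exists y.
Qed.

(** A point makes the supremum at least 0, which excludes the value [-oo] of an empty supremum. *)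
Lemma bounded_diamE (R : realType) (X : metricType R) :
  [set: X] !=set0 -> bounded_space X -> exists d : R, diam [set: X] = d%:E.
Proof.
move=> [x _]; rewrite /bounded_space => ltdy.
have d0 : 0%:E <= diam [set: X].
  by apply: ereal_sup_ubound; exists x => //; exists x => //; rewrite mdistxx.
by exists (fine (diam [set: X])); rewrite fineK// ge0_fin_numE.
Qed.

Theorem theorem2p1 (R : realType) (X : metricType R) (I : Type) (l : R)
    (X_neq0 : [set: X] !=set0) (X_bounded : bounded_space X)
    (m_ge1 : [set: I] !=set0) (m_le : [set: I] #<= [set: X])
    (l0 : (0 < l)%R) (l_lt : l%:E < diam [set: X]) :
  (exists D : I -> set X,
     partition [set: I] D [set: X] /\ strictly_smaller_diams D)
  <->
  2%:E * gromov_hausdorff_dist (rescale l0 (unit_simplex R I)) X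
    < diam [set: X].
Proof.
have [d dE] := bounded_diamE X_neq0 X_bounded.
have le_d (x y : X) : (mdist x y <= d)%R.
  move: x y; have /diam_leP dX : diam [set: X] <= d%:E by rewrite dE.
  by move=> x y; exact: dX.
move: l_lt; rewrite /strictly_smaller_diams dE lte_fin => l_lt; split.
  move=> [D [[Dcov Dtriv Dneq0] [e e0 De]]].
  have {}De i x y : D i x -> D i y -> (mdist x y <= d - e)%R.
    by move: x y; apply/diam_leP; rewrite EFinB; exact: De.
  (* [d - e] serves two points of the same part; for different parts, [l] and [d - l] bound the two
     signs of [l - mdist x y]. *)
  pose t : R := Num.max (d - e)%R (Num.max l (d - l))%R.
  have [te tl tdl] : [/\ d - e <= t, l <= t & d - l <= t]%R.
    by rewrite /t !le_max !lexx !orbT.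
  have td : (t < d)%R by rewrite /t !gt_max; apply/and3P; split; lra.
  apply: (@le_lt_trans _ _ t%:E); last by rewrite lte_fin.
  have -> : t%:E = 2%:E * (t / 2)%:E by rewrite -EFinM; congr EFin; lra.
  apply: lee_wpmul2l => //.
  have Dx x : exists i, D i x.
    by have : cover setT D x by [rewrite Dcov]; move=> [i _]; exists i.
  apply: (@gromov_hausdorff_le _ (rescale l0 (unit_simplex R I)) X
    [set p | D p.1 p.2]).
  - by have [x _] := X_neq0; have [i ix] := Dx x; exists (i, x).
  - lra.
  - by split=> // i; have [//|x ix] := Dneq0 i; exists x.
  - move=> [i x] [j y] /= ix jy; have xy0 := mdist_ge0 x y.
    have xyd := le_d x y.
    rewrite rescaleE unit_simplexE ler_norml.
    have [ij|ij] := eqVneq i j; last by rewrite mulr1; lra.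
    by have := De _ _ _ ix; rewrite ij => /(_ _ jy); rewrite mulr0; lra.
move=> gh_lt.
have [r ghr rd] : exists2 r : R,
    gromov_hausdorff_dist (rescale l0 (unit_simplex R I)) X < r%:E &
    (2 * r < d)%R.
  have : gromov_hausdorff_dist (rescale l0 (unit_simplex R I)) X < (d / 2)%:E.
    by rewrite -lte_pdivlMl// -EFinM mulrC in gh_lt.
  move=> /ereal_inf_lt[_ [s sS <-]]; rewrite lte_fin => sd.
  (* [s] only bounds the distance weakly; the midpoint of [s] and [d / 2] lies strictly between
     them. *)
  exists ((s + d / 2) / 2)%R; last lra.
  apply: (@le_lt_trans _ _ s%:E); last by rewrite lte_fin; lra.
  by apply: ereal_inf_lbound; exists s.
have [P [_ PX] Pr] := gromov_hausdorff_lt ghr.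
have [c Pc] := choice PX.
have [D' D'surj D'c] := surjective_refinement c m_le.
exists (fun i => D' @^-1` [set i]); split.
  split.
  - by apply/seteqP; split=> // x _; exists (D' x).
  - by move=> i j _ _ [x [<- <-]].
  - by move=> i _; have [x xi] := D'surj i; exists x.
(* With this choice the required bound is [2 * r]: points of one part share a vertex under [c], so
   the distortion bound applies to their distance alone. *)
exists (d - 2 * r)%R; first by rewrite subr_gt0.
move=> i; rewrite -EFinB; apply/diam_leP => x y /= xi yi.
have cxy : c x = c y by apply: D'c; rewrite xi yi.
have := Pr _ _ (Pc x) (Pc y).
by rewrite /= cxy mdistxx sub0r normrN ger0_norm ?mdist_ge0//; lra.
Qed.
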